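(* Let $D$ be a downward-closed family of subsets of $[n]$, and let $\phi:D\to D$ be any map with $\phi(a)\subseteq a$ for all $a\in D$. Then there exists a bijection $\pi:D\to D$ such that $a\cap\pi(a)=\phi(a)$ for all $a\in D$.
   Context: A family $D$ of subsets of $[n]$ is downward-closed if $b\subseteq a$ and $a\in D$ imply $b\in D$. *)

(* Defs.v *)
From mathcomp Require Import all_boot.

Set Implicit Arguments.
Unset Strict Implicit.
Unset Printing Implicit Defensive.

Definition downward_closed (n : nat) (D : {set {set 'I_n}}) : Prop :=
  forall a b : {set 'I_n}, b \subset a -> a \in D -> b \in D.

(* Main.v *)
(** The 0/1 matrix with an entry 1 at (a, b) iff [a :&: b = phi a] is
    nonsingular, so some term of the Leibniz expansion of its determinant is
    nonzero, and that term is the required permutation.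

    For nonsingularity, let f be in the kernel and put S(a, c) for the sum of
    the f b over the b in D with [a :&: b = c], so that S(a, phi a) = 0.  If i is
    in [c \subset a] then S(a, c) + S(a, c :\ i) = S(a :\ i, c :\ i).  By
    induction on a the right-hand side vanishes, so the S(a, c) agree up to sign
    for all [c \subset a], and one of them is 0.  Hence all S(a, c) vanish; but
    S(a, a) = f a if a is maximal with f a nonzero, so f = 0. *)

Require Import Defs.
From mathcomp Require Import all_boot.
From mathcomp Require Import fingroup perm ssralg matrix mxalgebra rat.

Set Implicit Arguments.
Unset Strict Implicit.
Unset Printing Implicit Defensive.

Import GRing.Theory.
Local Open Scope ring_scope.

Lemma perm_of_kernel0 (F : fieldType) (T : finType) (r : rel T) :
    (forall f : T -> F, (forall x, \sum_(y | r x y) f y = 0) -> f =1 fun=> 0) ->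
  exists s : {perm T}, forall x, r x (s x).
Proof.
move=> ker0.
(* The indices are transposed because [det0P] yields a row vector [v] with [v *m A = 0]; its entries
   then give a function to which [ker0] applies. *)
pose A : 'M[F]_#|T| := \matrix_(i, j) (r (enum_val j) (enum_val i))%:R.
have detA : \det A != 0.
  apply/det0P => -[v /eqP vN0 vA0]; apply: vN0.
  have v0 := ker0 (fun y => v ord0 (enum_rank y)).
  apply/rowP => i; rewrite mxE -[i]enum_valK ord1 v0 // => x.
  have := congr1 (fun w : 'rV_#|T| => w ord0 (enum_rank x)) vA0.
  rewrite !mxE => sum0; rewrite -[RHS]sum0 big_mkcond.
  rewrite (reindex (fun j : 'I_#|T| => enum_val j)) /=; last exact/onW_bij/enum_val_bij.
  apply: eq_bigr => j _; rewrite mxE enum_rankK enum_valK.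
  by case: (r _ _); rewrite ?mulr1 ?mulr0.
have [s As | A0] :=
  pickP (fun s : {perm 'I_#|T|} => \prod_i A i (s i) != 0); last first.
  case/eqP: detA; rewrite /determinant big1 // => s _.
  by move/negbFE/eqP: (A0 s) => ->; rewrite mulr0.
(* Because of the transposition, [s] sends the index of y to that of some x with [r x y], so its
   inverse is needed. *)
have g_inj : injective (fun x : T => enum_val ((s^-1)%g (enum_rank x))).
  by move=> x y /enum_val_inj/perm_inj/enum_rank_inj.
exists (perm g_inj) => x; rewrite permE.
move: As => /prodf_neq0/(_ ((s^-1)%g (enum_rank x)) isT).
by rewrite mxE permKV enum_rankK; case: (r _ _); rewrite ?eqxx.
Qed.

Section TraceSums.

Variables (V : zmodType) (T : finType) (D : {set {set T}}).
Implicit Types (a c d : {set T}) (b : {b : {set T} | b \in D}).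
Variable f : {b : {set T} | b \in D} -> V.

Definition trace_sum a c : V := \sum_(b | a :&: val b == c) f b.

Lemma trace_sumD1 a c i : c \subset a -> i \in c ->
  trace_sum a c + trace_sum a (c :\ i) = trace_sum (a :\ i) (c :\ i).
Proof.
move=> sca ic; have ia := subsetP sca i ic.
rewrite /trace_sum [RHS](bigID (fun b => i \in val b)) /=.
have capD1 b : (a :\ i) :&: val b = (a :&: val b) :\ i by rewrite setIDAC.
congr (_ + _); apply: eq_bigl => b; rewrite capD1.
  apply/eqP/andP => [def_c | [/eqP eq_c ib]].
    by rewrite def_c eqxx; move: ic; rewrite -def_c inE => /andP[].
  have iab : i \in a :&: val b by rewrite inE ia.
  by rewrite -(setD1K iab) eq_c setD1K.
apply/eqP/andP => [def_c | [/eqP eq_c ib]].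
  split; first by rewrite def_c; apply/eqP/setP=> j; rewrite !inE; case: eqP.
  have : i \notin a :&: val b by rewrite def_c setD11.
  by rewrite inE ia.
rewrite -eq_c; apply/setP=> j; rewrite !inE.
by have [->|] := eqVneq j i; rewrite ?(negbTE ib) ?andbF.
Qed.

Lemma trace_sum_eq0 (phi : {set T} -> {set T}) :
    (forall a b : {set T}, b \subset a -> a \in D -> b \in D) ->
    {in D, forall a, phi a \subset a} ->
    {in D, forall a, trace_sum a (phi a) = 0} ->
  forall a c, a \in D -> c \subset a -> trace_sum a c = 0.
Proof.
move=> hD sphi phi0 a; have [k] := ubnP #|a|; elim: k a => // k IHk a lt_a_k.
move=> c aD sca.
(* Only vanishing is compared, so no signs need tracking. *)
have step d i : d \subset a -> i \in d ->
    (trace_sum a d == 0) = (trace_sum a (d :\ i) == 0).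
  move=> sda id_; have ia := subsetP sda i id_.
  have sum0 : trace_sum a d + trace_sum a (d :\ i) = 0.
    rewrite trace_sumD1 //; apply: IHk; last exact: setSD.
      by move: lt_a_k; rewrite (cardsD1 i) ia.
    (* Downward closure keeps [a :\ i] in [D], within reach of the induction. *)
    by apply: hD aD; apply: subD1set.
  by rewrite -(oppr_eq0 (trace_sum a (_ :\ _))) -(addr0_eq sum0) opprK.
have all_eq d : d \subset a -> (trace_sum a d == 0) = (trace_sum a set0 == 0).
  have [m] := ubnP #|d|; elim: m d => // m IHm d lt_d_m sda.
  have [->//|[i id_]] := set_0Vmem d.
  rewrite (step d i) // IHm //; first by move: lt_d_m; rewrite (cardsD1 i) id_.
  exact: subset_trans (subD1set _ _) sda.
by apply/eqP; rewrite all_eq // -(all_eq _ (sphi _ aD)) phi0.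
Qed.

Lemma trace_sum_diag_eq0 :
  {in D, forall a, trace_sum a a = 0} -> f =1 fun=> 0.
Proof.
move=> sum0 b0; apply/eqP/negPn/negP => fb0.
case: (@arg_maxnP _ b0 (fun b => f b != 0) (fun b => #|val b|) fb0) => b fb bmax.
case/eqP: fb; rewrite -(sum0 _ (valP b)) /trace_sum (bigD1 b) ?setIid //=.
(* Any other [b'] in the sum strictly contains [b], so [f b'] is zero because [b] has maximal
   cardinality in the support. *)
rewrite big1 ?addr0 // => b' /andP[/eqP/setIidPl sbb' nb'b].
apply/eqP/negPn/negP => /bmax le_b'b; case/eqP: nb'b; apply/val_inj/esym/eqP.
by rewrite eqEcard sbb'.
Qed.

End TraceSums.

Local Close Scope ring_scope.

Theorem theorem7 (n : nat) (D : {set {set 'I_n}}) (hD : downward_closed D)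
    (phi : {a : {set 'I_n} | a \in D} -> {a : {set 'I_n} | a \in D})
    (hphi : forall a : {a : {set 'I_n} | a \in D}, val (phi a) \subset val a) :
  exists pi : {a : {set 'I_n} | a \in D} -> {a : {set 'I_n} | a \in D},
    bijective pi /\
    forall a : {a : {set 'I_n} | a \in D}, val a :&: val (pi a) = val (phi a).
Proof.
(* Extends [phi] to all sets; the default [a] outside [D] is arbitrary. *)
pose phi' (a : {set 'I_n}) := if insub a is Some u then val (phi u) else a.
have phi'E u : phi' (val u) = val (phi u) by rewrite /phi' valK.
pose r (a b : {a : {set 'I_n} | a \in D}) := val a :&: val b == val (phi a).
have [f f0 | s rs] := @perm_of_kernel0 rat _ r.
  apply: trace_sum_diag_eq0 => a aD.
  apply: (@trace_sum_eq0 _ _ _ f phi' hD) => // {aD}a aD.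
    by rewrite -[a]/(val (exist (fun a => a \in D) a aD)) phi'E.
  by rewrite -[a]/(val (exist (fun a => a \in D) a aD)) phi'E; apply: f0.
exists s; split; first exact/injF_bij/perm_inj.
by move=> a; apply/eqP/rs.
Qed.
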